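(* Let $G$ be the single-layer ReLU network, $w_0\in\mathbb{R}^m$, $\varepsilon>0$, and let $G_r$ be the reduced order model constructed from $G$, $w_0$, $\varepsilon$ as in the context. Then $$G(w)=G_r(w)\qquad\text{for all } w\in\mathcal{B}_\varepsilon(w_0).$$
   Context: Network: $G:\mathbb{R}^m\to\mathbb{R}^l$, $G(w)=W_{\mathrm{out}}\Phi(W_{\mathrm{in}}w+b_{\mathrm{in}})$, with $W_{\mathrm{in}}\in\mathbb{R}^{n\times m}$, $W_{\mathrm{out}}\in\mathbb{R}^{l\times n}$, $b_{\mathrm{in}}\in\mathbb{R}^n$ (the output bias is taken to be zero), where $\Phi$ denotes the entrywise ReLU, $\Phi(q)_i=\max(q_i,0)$, in any dimension. $|\cdot|_2$ is the Euclidean norm and $\mathcal{B}_\varepsilon(w_0)=\{w\in\mathbb{R}^m:|w-w_0|_2\le\varepsilon\}$. Reduced order model: let $q_0=W_{\mathrm{in}}w_0+b_{\mathrm{in}}$ with entries $q_{0,i}$, let $W_{\mathrm{in},i}\in\mathbb{R}^{1\times m}$ be the $i$-th row of $W_{\mathrm{in}}$, and define $$\mathcal{Z}_n=\{1,\dots,n\},\quad \mathcal{N}_+=\{i\in\mathcal{Z}_n: q_{0,i}\ge\varepsilon|W_{\mathrm{in},i}|_2\},\quad \mathcal{N}_0=\{i\in\mathcal{Z}_n: q_{0,i}\le-\varepsilon|W_{\mathrm{in},i}|_2\},\quad \mathcal{N}_r=\mathcal{Z}_n\setminus(\mathcal{N}_+\cup\mathcal{N}_0).$$ Let $n_r=|\mathcal{N}_r|$.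 For an index set $\mathcal{N}\subset\mathcal{Z}_n$, $\bigoplus_{i\in\mathcal{N}}e_i\in\mathbb{R}^{|\mathcal{N}|\times n}$ is the matrix whose rows are the transposed unit vectors $e_i^T$, $i\in\mathcal{N}$, stacked vertically. Put $E_+=\bigoplus_{i\in\mathcal{N}_+}e_i$, $E_r=\bigoplus_{i\in\mathcal{N}_r}e_i$, and $$\tilde W_{\mathrm{in}}=E_+W_{\mathrm{in}},\ \tilde b_{\mathrm{in}}=E_+b_{\mathrm{in}},\ \tilde W_{\mathrm{out}}=W_{\mathrm{out}}E_+^T,\qquad \hat W_{\mathrm{in}}=E_rW_{\mathrm{in}},\ \hat b_{\mathrm{in}}=E_rb_{\mathrm{in}},\ \hat W_{\mathrm{out}}=W_{\mathrm{out}}E_r^T.$$ The reduced order model is $$G_r(w)=\tilde W_{\mathrm{out}}(\tilde W_{\mathrm{in}}w+\tilde b_{\mathrm{in}})+\hat W_{\mathrm{out}}\Phi(\hat W_{\mathrm{in}}w+\hat b_{\mathrm{in}}),$$ where terms corresponding to empty index sets are zero. *)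

(* Defs.v *)
From HB Require Import structures.
From mathcomp Require Import all_boot all_order all_algebra.
From mathcomp Require Import reals.

Set Implicit Arguments.
Unset Strict Implicit.
Unset Printing Implicit Defensive.

Import Order.TTheory GRing.Theory Num.Theory.
Local Open Scope ring_scope.

(* Applied only to matrices with a single row or a single column, where the
   double sum is the Euclidean sum of squares.  The norm [`|_|] that
   MathComp-Analysis puts on matrices is the max norm and is not used. *)
Definition norm2 (R : realType) (p q : nat) (A : 'M[R]_(p, q)) : R :=
  Num.sqrt (\sum_i \sum_j A i j ^+ 2).

Definition closed_ball2 (R : realType) (m : nat) (w0 : 'cV[R]_m) (eps : R) :
    {pred 'cV[R]_m} :=
  [pred w | norm2 (w - w0) <= eps].

Definition relu (R : realType) (p : nat) (q : 'cV[R]_p) : 'cV[R]_p :=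
  \col_i Num.max (q i 0) 0.

Definition network (R : realType) (m n l : nat) (Win : 'M[R]_(n, m))
    (bin : 'cV[R]_n) (Wout : 'M[R]_(l, n)) (w : 'cV[R]_m) : 'cV[R]_l :=
  Wout *m relu (Win *m w + bin).

Section ReducedOrderModel.
Variables (R : realType) (m n l : nat).
Variables (Win : 'M[R]_(n, m)) (bin : 'cV[R]_n) (Wout : 'M[R]_(l, n)).
Variables (w0 : 'cV[R]_m) (eps : R).

Definition preact0 : 'cV[R]_n := Win *m w0 + bin.

Definition idx_pos : {set 'I_n} :=
  [set i | preact0 i 0 >= eps * norm2 (row i Win)].

Definition idx_zero : {set 'I_n} :=
  [set i | preact0 i 0 <= - (eps * norm2 (row i Win))].

Definition idx_relu : {set 'I_n} := [set: 'I_n] :\: (idx_pos :|: idx_zero).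

(* The transposed unit vectors of the indices in [N], stacked vertically in
   increasing order of the index.  When [N] is empty this has no rows, so the
   products below that go through it are zero. *)
Definition stack_e (N : {set 'I_n}) : 'M[R]_(#|N|, n) :=
  \matrix_(k < #|N|) delta_mx 0 (enum_val k).

Definition reduced_network (w : 'cV[R]_m) : 'cV[R]_l :=
  let Ep := stack_e idx_pos in
  let Er := stack_e idx_relu in
  let Win_t := Ep *m Win in
  let bin_t := Ep *m bin in
  let Wout_t := Wout *m Ep^T in
  let Win_h := Er *m Win in
  let bin_h := Er *m bin in
  let Wout_h := Wout *m Er^T in
  Wout_t *m (Win_t *m w + bin_t) + Wout_h *m relu (Win_h *m w + bin_h).

End ReducedOrderModel.

(* Main.v *)
(** On the ball, Cauchy-Schwarz bounds the variation of the [i]-th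
    preactivation by [eps * norm2 (row i Win)]; so it keeps a constant sign
    for [i] in [idx_pos] or [idx_zero], where ReLU is the identity or zero.
    Rows in both sets have a vanishing preactivation on the whole ball, so
    the overlap is harmless. *)
Require Import Defs.
From mathcomp Require Import all_boot all_order all_algebra.
From mathcomp Require Import reals.
From mathcomp Require Import ring lra.
Import Order.TTheory GRing.Theory Num.Theory.
Local Open Scope ring_scope.

(** The sum of the squares [(B * a i - C * b i) ^+ 2] equals [B * (A * B - C ^+ 2)], so dividing by
    [B > 0] gives the bound; [B = 0] forces every [b i] to vanish. *)
Lemma cauchy_schwarz_sum (R : realFieldType) (I : finType) (a b : I -> R) :
  (\sum_i a i * b i) ^+ 2 <= (\sum_i a i ^+ 2) * (\sum_i b i ^+ 2).
Proof.
set A := \sum_i a i ^+ 2; set B := \sum_i b i ^+ 2; set C := \sum_i a i * b i.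
have B_ge0 : 0 <= B by apply: sumr_ge0 => i _; apply: sqr_ge0.
have key : \sum_i (B * a i - C * b i) ^+ 2 = B * (A * B - C ^+ 2).
  transitivity (\sum_i (B ^+ 2 * a i ^+ 2 - 2 * B * C * (a i * b i)
                        + C ^+ 2 * b i ^+ 2)).
    by apply: eq_bigr => i _; ring.
  rewrite big_split /= sumrB -!mulr_sumr -/A -/B -/C; ring.
have [B0|B_neq0] := eqVneq B 0; last first.
  rewrite -subr_ge0 -(@pmulr_rge0 _ B) ?lt_def ?B_neq0 // -key.
  by apply: sumr_ge0 => i _; apply: sqr_ge0.
have b0 i : b i = 0.
  apply/eqP; rewrite -sqrf_eq0; apply/eqP.
  by apply: (psumr_eq0P _ B0) => // j _; apply: sqr_ge0.
rewrite B0 mulr0 /C big1 ?expr0n // => i _.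
by rewrite b0 mulr0.
Qed.

Lemma norm2_ge0 (R : realType) (p q : nat) (A : 'M[R]_(p, q)) : 0 <= norm2 A.
Proof. exact: sqrtr_ge0. Qed.

Lemma normr_mulmx_le_norm2 (R : realType) (m : nat) (a : 'rV[R]_m)
    (b : 'cV[R]_m) : `|(a *m b) 0 0| <= norm2 a * norm2 b.
Proof.
rewrite -(@ler_pXn2r _ 2) ?nnegrE ?mulr_ge0 ?norm2_ge0 // real_normK ?num_real //.
rewrite exprMn !sqr_sqrtr; try by do 2![apply: sumr_ge0 => ? _]; apply: sqr_ge0.
rewrite mxE big_ord1.
under [X in _ <= _ * X]eq_bigr do rewrite big_ord1.
exact: cauchy_schwarz_sum.
Qed.

Lemma preact_ball_bound (R : realType) (m n : nat) (Win : 'M[R]_(n, m))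
    (bin : 'cV[R]_n) (w0 w : 'cV[R]_m) (eps : R) (i : 'I_n) :
    w \in closed_ball2 w0 eps ->
  `|(Win *m w + bin) i 0 - preact0 Win bin w0 i 0| <= eps * norm2 (row i Win).
Proof.
rewrite inE => le_eps.
have -> : (Win *m w + bin) i 0 - preact0 Win bin w0 i 0
          = (row i Win *m (w - w0)) 0 0.
  by rewrite -row_mul mulmxBr !mxE; ring.
apply: le_trans (normr_mulmx_le_norm2 _ _ _ _) _.
by rewrite mulrC; apply: ler_wpM2r le_eps; apply: norm2_ge0.
Qed.

Lemma stack_e_mulE (R : realType) (n p : nat) (N : {set 'I_n})
    (A : 'M[R]_(n, p)) k j : (stack_e R N *m A) k j = A (enum_val k) j.
Proof.
have -> : (stack_e R N *m A) k j = row k (stack_e R N *m A) 0 j by rewrite [RHS]mxE.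
by rewrite row_mul rowK -rowE mxE.
Qed.

(** Selecting rows commutes with an entrywise map; this exposes the product [E^T *m E] in the ReLU
    part of the reduced model. *)
Lemma relu_stack_e (R : realType) (n : nat) (N : {set 'I_n}) (x : 'cV[R]_n) :
  relu (stack_e R N *m x) = stack_e R N *m relu x.
Proof. by apply/colP => k; rewrite mxE !stack_e_mulE mxE. Qed.

(** [E^T *m E] is the coordinate projection onto [N]: reindexed by [enum_val], the sum runs over [N]
    and only the term at [i] can survive. *)
Lemma trmx_stack_e_mul (R : realType) (n : nat) (N : {set 'I_n})
    (x : 'cV[R]_n) i :
  ((stack_e R N)^T *m (stack_e R N *m x)) i 0 = if i \in N then x i 0 else 0.
Proof.
rewrite mxE.
under eq_bigr do rewrite stack_e_mulE !mxE eqxx /=.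
rewrite -(big_enum_val (fun j => (i == j)%:R * x j 0)) /=.
case: ifPn => [iN|/negP iN].
  rewrite (bigD1 i) //= eqxx mul1r big1 ?addr0 // => j /andP[_ /negPf].
  by rewrite eq_sym => ->; rewrite mul0r.
by rewrite big1 // => j jN; case: eqP => [ij|_]; [case: iN; rewrite ij | rewrite mul0r].
Qed.

Theorem theorem5 (R : realType) (m n l : nat) (Win : 'M[R]_(n, m))
    (bin : 'cV[R]_n) (Wout : 'M[R]_(l, n)) (w0 : 'cV[R]_m) (eps : R)
    (eps_gt0 : 0 < eps) :
  forall w : 'cV[R]_m, w \in closed_ball2 w0 eps ->
    network Win bin Wout w = reduced_network Win bin Wout w0 eps w.
Proof.
move=> w w_ball; rewrite /network /reduced_network /=.
(* Factoring [Wout] out of both parts leaves an identity between hidden-layer vectors, checked entry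
   by entry. *)
rewrite -!mulmxA -!mulmxDr relu_stack_e; congr (_ *m _).
apply/colP => i; rewrite [RHS]mxE !trmx_stack_e_mul.
have := preact_ball_bound _ _ _ Win bin _ _ _ i w_ball.
rewrite ler_norml => /andP[lo hi].
rewrite /idx_relu !inE [relu _ i 0]mxE.
(* Testing [idx_pos] first settles the overlap with [idx_zero]: [lo] gives a nonnegative
   preactivation here, and [hi] a nonpositive one in the next case. *)
case: leP => [pos|_] /=.
  by rewrite addr0 max_l //; lra.
case: leP => [zero|_] /=; last by rewrite add0r.
by rewrite addr0 max_r //; lra.
Qed.
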